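(* Let $\Omega$ be a non-empty bounded open subset of $\mathbf{R}^2$, let $h:\Omega\to\mathbf{R}$ be a continuous non-negative function, and let $w\in C^2(\Omega)$ satisfy in $\Omega$ the Monge–Ampère equation $w_{xx}w_{yy}-w_{xy}^2=h$. Then the gradient $(w_x,w_y):\Omega\to\mathbf{R}^2$ satisfies the convex hull-like property in $\Omega$.
   Context: A function $\psi:\mathbf{R}^2\to\mathbf{R}$ is quasi-convex if for each $r\in\mathbf{R}$ the set $\psi^{-1}(]-\infty,r])$ is convex. A continuous function $f:\Omega\to\mathbf{R}^2$ satisfies the convex hull-like property in $\Omega$ if for every continuous quasi-convex $\psi:\mathbf{R}^2\to\mathbf{R}$ there exists $x^*\in\partial\Omega$ such that $\limsup_{x\to x^*,\,x\in\Omega}\psi(f(x))=\sup_{x\in\Omega}\psi(f(x))$. *)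

(* Defs.v *)
From Stdlib Require Import Reals.
From Coquelicot Require Import Coquelicot.
Open Scope R_scope.

Definition pt := (R * R)%type.

Definition dist2 (p q : pt) : R :=
  sqrt ((fst p - fst q) ^ 2 + (snd p - snd q) ^ 2).

Definition bounded2 (S : pt -> Prop) : Prop :=
  exists M : R, forall p, S p -> dist2 p (0, 0) <= M.

Definition closure2 (S : pt -> Prop) (x : pt) : Prop :=
  forall eps : R, 0 < eps -> exists y, S y /\ dist2 y x < eps.

Definition boundary2 (S : pt -> Prop) (x : pt) : Prop :=
  closure2 S x /\ closure2 (fun y => ~ S y) x.

Definition convex2 (S : pt -> Prop) : Prop :=
  forall p q t, S p -> S q -> 0 <= t <= 1 ->
    S (t * fst p + (1 - t) * fst q, t * snd p + (1 - t) * snd q).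

Definition quasi_convex (psi : pt -> R) : Prop :=
  forall r : R, convex2 (fun p => psi p <= r).

Definition sup_on (S : pt -> Prop) (g : pt -> R) : Rbar :=
  Lub_Rbar (fun r => exists p, S p /\ r = g p).

Definition limsup_within (S : pt -> Prop) (g : pt -> R) (x0 : pt) : Rbar :=
  Inf_seq (fun n : nat =>
    Lub_Rbar (fun r => exists p, S p /\ dist2 p x0 < / (INR n + 1) /\ r = g p)).

Definition convex_hull_like (Omega : pt -> Prop) (f : pt -> pt) : Prop :=
  forall psi : pt -> R,
    (forall p, continuous psi p) -> quasi_convex psi ->
    exists xs, boundary2 Omega xs /\
      limsup_within Omega (fun x => psi (f x)) xs = sup_on Omega (fun x => psi (f x)).

Definition pdx (f : pt -> R) (p : pt) : R := Derive (fun t => f (t, snd p)) (fst p).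
Definition pdy (f : pt -> R) (p : pt) : R := Derive (fun t => f (fst p, t)) (snd p).

Definition ex_d1 (f : pt -> R) (p : pt) : Prop := ex_derive (fun t => f (t, snd p)) (fst p).
Definition ex_d2 (f : pt -> R) (p : pt) : Prop := ex_derive (fun t => f (fst p, t)) (snd p).

Definition C2_on (Omega : pt -> Prop) (w : pt -> R) : Prop :=
  forall p, Omega p ->
    continuous w p /\
    ex_d1 w p /\ ex_d2 w p /\
    continuous (pdx w) p /\ continuous (pdy w) p /\
    ex_d1 (pdx w) p /\ ex_d2 (pdx w) p /\ ex_d1 (pdy w) p /\ ex_d2 (pdy w) p /\
    continuous (pdx (pdx w)) p /\ continuous (pdy (pdx w)) p /\
    continuous (pdx (pdy w)) p /\ continuous (pdy (pdy w)) p.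

(* Main.v *)
(** Suppose no boundary point works for [psi], and write [g = psi o f] with
    [f] the gradient of [w].  By compactness [g] attains its supremum over
    [Omega] at some [x0], while [g <= r < g x0] near the boundary for a single
    [r].  Separate [f x0] from the closed convex set [{psi <= r}] by a linear
    form [e].  For small [lam > 0] the function
    [p |-> e . f p + lam * (e rotated by a right angle) . p] still has an
    interior maximum on [Omega].  Its gradient vanishes there, and since the
    Jacobian matrix of [f] is symmetric this forces its determinant to be
    [- lam ^ 2 < 0]. *)

Require Import Defs.
From Stdlib Require Import Reals Lra List Classical ClassicalEpsilon.
From Coquelicot Require Import Coquelicot.
Open Scope R_scope.

(** * Euclidean distance and compactness in the plane *)

Lemma abs_coord_le_dist2 (p q : pt) :
  Rabs (fst p - fst q) <= dist2 p q /\ Rabs (snd p - snd q) <= dist2 p q.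
Proof.
  unfold dist2; split; rewrite <- sqrt_Rsqr_abs; apply sqrt_le_1_alt;
    unfold Rsqr; [pose proof (pow2_ge_0 (snd p - snd q))
                 |pose proof (pow2_ge_0 (fst p - fst q))]; lra.
Qed.

Lemma dist2_le_abs_coord (p q : pt) :
  dist2 p q <= Rabs (fst p - fst q) + Rabs (snd p - snd q).
Proof.
  unfold dist2.
  rewrite <- (sqrt_Rsqr (Rabs _ + Rabs _)).
  2: pose proof (Rabs_pos (fst p - fst q)); pose proof (Rabs_pos (snd p - snd q)); lra.
  apply sqrt_le_1_alt; rewrite <- (pow2_abs (fst p - fst q)),
    <- (pow2_abs (snd p - snd q)); unfold Rsqr.
  pose proof (Rmult_le_pos _ _ (Rabs_pos (fst p - fst q)) (Rabs_pos (snd p - snd q))).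
  lra.
Qed.

Lemma locally_dist2 (x : pt) (P : pt -> Prop) :
  locally x P <-> exists eps, 0 < eps /\ forall p, dist2 p x < eps -> P p.
Proof.
  split.
  - intros [d Hd]; exists d; split; [apply cond_pos|].
    intros p Hp; apply Hd; destruct (abs_coord_le_dist2 p x).
    split; apply Rle_lt_trans with (dist2 p x); assumption.
  - intros [e [He H]].
    assert (He2 : 0 < e / 2) by lra.
    exists (mkposreal _ He2); intros p [H1 H2]; apply H.
    apply Rle_lt_trans with (1 := dist2_le_abs_coord p x).
    rewrite <- (Rplus_half_diag e); apply Rplus_lt_compat; assumption.
Qed.

(** Finitely many of the neighbourhoods given by the last hypothesis cover a square containing [D],
    and [P] passes to their union by induction on the list. Since that hypothesis concerns every
    point of the plane, [D] may fail to be closed. *)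
Lemma bounded2_compact_induction (D : pt -> Prop) (P : (pt -> Prop) -> Prop) :
  bounded2 D ->
  P (fun _ => False) ->
  (forall A B : pt -> Prop, (forall p, A p -> B p) -> P B -> P A) ->
  (forall A B, P A -> P B -> P (fun p => A p \/ B p)) ->
  (forall x, exists A, locally x A /\ P A) ->
  P D.
Proof.
  intros [M HM] P0 Psub PU Ploc.
  assert (Hd : forall x : Compactness.Tn 2 R, exists d : posreal,
    P (fun p => ball (fst x, fst (snd x)) d p)).
  { intros [x [y []]]; destruct (Ploc (x, y)) as [A [[d Hd] HA]].
    exists d; apply Psub with A; assumption. }
  set (delta x := proj1_sig (constructive_indefinite_description _ (Hd x))).
  assert (Hdelta := fun x => proj2_sig (constructive_indefinite_description _ (Hd x))).
  (* [compactness_list] gives the finite list only under a double negation, so the goal is first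
     turned into a refutation. *)
  apply NNPP; intros NP.
  apply (compactness_list 2 (- M, (- M, tt)) (M, (M, tt)) delta).
  intros [l Hl]; apply NP.
  assert (Hfin : P (fun p => exists t, In t l /\
    ball (fst t, fst (snd t)) (delta t) p)).
  { clear Hl; induction l as [|t l IH].
    - apply Psub with (2 := P0); intros p [t [[] _]].
    - apply Psub with (2 := PU _ _ (Hdelta t) IH).
      intros p [s [[->|Hs] Hp]]; [left|right; exists s]; auto. }
  apply Psub with (2 := Hfin); intros [x y] Hp.
  specialize (HM _ Hp); destruct (abs_coord_le_dist2 (x, y) (0, 0)) as [Hx Hy].
  simpl in Hx, Hy; rewrite Rminus_0_r in Hx, Hy.
  destruct (Hl (x, (y, tt))) as [[u [v []]] [Hin [_ Hc]]].
  - simpl; apply Rle_trans with (2 := HM) in Hx; apply Rle_trans with (2 := HM) in Hy.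
    apply Rabs_le_between in Hx; apply Rabs_le_between in Hy; tauto.
  - exists (u, (v, tt)); split; [exact Hin|].
    destruct Hc as [Hcx [Hcy _]]; split; assumption.
Qed.

(* The hypothesis on points outside [D] replaces closedness of [D]: no
   maximizing sequence converges to such a point. *)
Lemma max_attained (D : pt -> Prop) (g : pt -> R) :
  bounded2 D -> (exists p, D p) ->
  (forall x, ~ D x -> exists q, D q /\ locally x (fun p => D p -> g p < g q)) ->
  (forall x, D x -> continuous g x) ->
  exists x0, D x0 /\ forall p, D p -> g p <= g x0.
Proof.
  intros HB [a Ha] Hout Hc; apply NNPP; intros Hno.
  assert (Hlt : forall x, D x -> exists q, D q /\ g x < g q).
  { intros x Hx; apply NNPP; intros H; apply Hno; exists x; split; [exact Hx|].
    intros p Hp; apply Rnot_lt_le; intros Hlt; apply H; exists p; auto. }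
  (* Without a maximum, each value is exceeded by some [g q], and by continuity also nearby. Of two
     such [q] the one with the larger value serves the union, so a single [q] would dominate all of
     [D] strictly, itself included. *)
  assert (HP : exists q, D q /\ forall p, D p -> D p -> g p < g q).
  { apply (bounded2_compact_induction D
      (fun A => exists q, D q /\ forall p, A p -> D p -> g p < g q)).
    - exact HB.
    - exists a; split; [exact Ha|tauto].
    - intros A B HAB [q [Hq H]]; exists q; split; auto.
    - intros A B [q [Hq H]] [q' [Hq' H']].
      destruct (Rle_lt_dec (g q) (g q')) as [Hle|Hle]; [exists q'|exists q];
        (split; [assumption|]); intros p [Hp|Hp] HDp.
      + apply Rlt_le_trans with (2 := Hle); auto.
      + auto.
      + auto.
      + apply Rlt_trans with (2 := Hle); auto.
    - intros x; destruct (classic (D x)) as [Hx|Hx].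
      + destruct (Hlt x Hx) as [q [Hq Hgq]].
        exists (fun p => g p < g q); split.
        * apply (Hc x Hx (fun y => y < g q)), open_lt; exact Hgq.
        * exists q; auto.
      + destruct (Hout x Hx) as [q [Hq Hloc]].
        exists (fun p => D p -> g p < g q); split; [exact Hloc|].
        exists q; auto. }
  destruct HP as [q [Hq H]]; specialize (H q Hq Hq); lra.
Qed.

(** * Behaviour of a function near the complement of its domain *)

Lemma not_closure2_locally (D : pt -> Prop) (x : pt) :
  ~ closure2 D x -> locally x (fun p => ~ D p).
Proof.
  intros H; apply locally_dist2; apply NNPP; intros HN; apply H; intros eps He.
  apply NNPP; intros Hy; apply HN; exists eps; split; [exact He|].
  intros p Hp HDp; apply Hy; exists p; auto.
Qed.

(** By contraposition: if no such [q] and [r] exist, the supremum over every ball around [x] is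
    already [sup_on D g], and the limsup is the infimum of a constant sequence. Infinite suprema are
    covered as well. *)
Lemma limsup_within_lt_sup_on (D : pt -> Prop) (g : pt -> R) (x : pt) :
  limsup_within D g x <> sup_on D g ->
  exists q r, D q /\ r < g q /\ locally x (fun p => D p -> g p <= r).
Proof.
  intros Hne; apply NNPP; intros Hno; apply Hne.
  unfold limsup_within.
  assert (Hcst : forall n : nat,
    Lub_Rbar (fun r => exists p, D p /\ dist2 p x < / (INR n + 1) /\ r = g p)
    = sup_on D g).
  { intros n; apply is_lub_Rbar_unique; split.
    - intros s [p [Hp [_ ->]]]; apply Lub_Rbar_correct; exists p; auto.
    - intros b Hb; apply Lub_Rbar_correct; intros s [q [Hq ->]].
      apply Rbar_not_lt_le; intros Hlt.
      (* The bound [b] can be [m_infty], when the ball contains no point of [D]; a real level is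
         still required. *)
      assert (Hr : exists r : R, Rbar_le b r /\ r < g q).
      { destruct b as [b| |].
        - exists ((b + g q) / 2); simpl in *; lra.
        - destruct Hlt.
        - exists (g q - 1); simpl; lra. }
      destruct Hr as [r [Hbr Hrq]]; apply Hno; exists q, r.
      repeat split; trivial.
      apply locally_dist2; exists (/ (INR n + 1)); split.
      + apply Rinv_0_lt_compat; pose proof (pos_INR n); lra.
      + intros p Hp HDp; apply (Rbar_le_trans (g p) b r); [|exact Hbr].
        apply Hb; exists p; auto. }
  rewrite (Inf_seq_ext _ (fun _ => sup_on D g) Hcst).
  apply is_inf_seq_unique; destruct (sup_on D g) as [l| |]; simpl.
  - intros eps; pose proof (cond_pos eps); split; [intros _|exists 0%nat]; simpl; lra.
  - intros M n; exact I.
  - intros M; exists 0%nat; exact I.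
Qed.

(** Compactness turns levels depending on the point into a single one, still below the maximum. *)
Lemma max_near_complement (D : pt -> Prop) (g : pt -> R) (x0 : pt) :
  open D -> bounded2 D -> D x0 -> (forall p, D p -> g p <= g x0) ->
  (forall x, ~ D x ->
     exists q r, D q /\ r < g q /\ locally x (fun p => D p -> g p <= r)) ->
  exists r, r < g x0 /\ forall x, ~ D x -> locally x (fun p => D p -> g p <= r).
Proof.
  intros HO HB Hx0 Hmax Hout.
  (* Points of [D] with [g] above [r] have their [d]-ball inside [D]. Locally this follows from
     openness at a point of [D], and is vacuous at a point outside. Unions take the larger [r] and
     the smaller [d]. *)
  assert (HP : exists r d : R, r < g x0 /\ 0 < d /\ forall p, D p -> D p ->
    r < g p -> forall x, ball x d p -> D x).
  { apply (bounded2_compact_induction D (fun A => exists r d : R, r < g x0 /\ 0 < d /\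
      forall p, A p -> D p -> r < g p -> forall x, ball x d p -> D x)).
    - exact HB.
    - exists (g x0 - 1), 1; repeat split; try lra; tauto.
    - intros A B HAB [r [d [Hr [Hd H]]]]; exists r, d; repeat split; auto.
      intros p Hp; apply H; auto.
    - intros A B [r [d [Hr [Hd H]]]] [r' [d' [Hr' [Hd' H']]]].
      exists (Rmax r r'), (Rmin d d').
      split; [apply Rmax_lub_lt; assumption|].
      split; [apply Rmin_glb_lt; assumption|].
      intros p [Hp|Hp] HDp Hlt x Hx.
      + apply (H p); auto.
        * apply Rle_lt_trans with (2 := Hlt), Rmax_l.
        * apply ball_le with (2 := Hx), Rmin_l.
      + apply (H' p); auto.
        * apply Rle_lt_trans with (2 := Hlt), Rmax_r.
        * apply ball_le with (2 := Hx), Rmin_r.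
    - intros x; destruct (classic (D x)) as [Hx|Hx].
      + destruct (HO x Hx) as [d Hd].
        exists (ball x (d / 2)); split.
        * apply (locally_ball x (mkposreal _ (is_pos_div_2 d))).
        * exists (g x0 - 1), (d / 2); split; [lra|].
          split; [apply is_pos_div_2|].
          intros p Hp _ _ y Hy; apply Hd.
          rewrite <- (Rplus_half_diag d); apply ball_triangle with p; [exact Hp|].
          apply ball_sym; exact Hy.
      + destruct (Hout x Hx) as [q [r [Hq [Hr Hloc]]]].
        exists (fun p => D p -> g p <= r); split; [exact Hloc|].
        exists r, 1; split; [|split; [lra|]].
        * apply Rlt_le_trans with (1 := Hr); auto.
        * intros p Hp HDp Hlt; specialize (Hp HDp); lra. }
  destruct HP as [r [d [Hr [Hd H]]]]; exists r; split; [exact Hr|].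
  intros x Hx; exists (mkposreal d Hd); intros p Hp HDp.
  apply Rnot_lt_le; intros Hlt; apply Hx, (H p); auto.
Qed.

(** * Separating a point from a closed convex set *)

Lemma continuous_lincomb (F G : pt -> R) (a b : R) (x : pt) :
  continuous F x -> continuous G x -> continuous (fun p => a * F p + b * G p) x.
Proof.
  intros HF HG.
  apply (continuous_plus (K := R_AbsRing) (V := R_NormedModule)
    (fun p => a * F p) (fun p => b * G p));
  apply (continuous_scal_r (K := R_AbsRing) (V := R_NormedModule)); assumption.
Qed.

Lemma continuous_fst_pt (x : pt) : continuous (fun p : pt => fst p) x.
Proof. destruct x as [u v]; apply continuous_fst. Qed.

Lemma continuous_snd_pt (x : pt) : continuous (fun p : pt => snd p) x.
Proof. destruct x as [u v]; apply continuous_snd. Qed.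

Lemma continuous_sqr_sub (F : pt -> R) (c : R) (x : pt) :
  continuous F x -> continuous (fun p => (F p - c) ^ 2) x.
Proof.
  intros HF; apply (continuous_comp F (fun t => (t - c) ^ 2)); [exact HF|].
  apply continuity_pt_filterlim, derivable_continuous_pt, ex_derive_Reals_0.
  auto_derive; trivial.
Qed.

Lemma bounded2_bound (D : pt -> Prop) (M : R) :
  (forall p, D p -> Rabs (fst p) + Rabs (snd p) <= M) -> bounded2 D.
Proof.
  intros H; exists M; intros p Hp.
  apply Rle_trans with (1 := dist2_le_abs_coord p (0, 0)).
  simpl; rewrite !Rminus_0_r; auto.
Qed.

(** Only the part of [C] no farther from [y] than [c0] matters; it is bounded, so [max_attained]
    applies to minus the squared distance. *)
Lemma nearest_point (C : pt -> Prop) (y : pt) :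
  (exists c, C c) -> closed C ->
  exists z, C z /\ forall c, C c ->
    (fst z - fst y) ^ 2 + (snd z - snd y) ^ 2 <=
    (fst c - fst y) ^ 2 + (snd c - snd y) ^ 2.
Proof.
  intros [c0 Hc0] Hcl.
  set (N := fun c : pt => 1 * (fst c - fst y) ^ 2 + 1 * (snd c - snd y) ^ 2).
  assert (HN : forall c, continuous N c).
  { intros c; apply continuous_lincomb; apply continuous_sqr_sub;
      [apply continuous_fst_pt|apply continuous_snd_pt]. }
  destruct (max_attained (fun c => C c /\ N c <= N c0) (fun c => - N c))
    as [z [[Hz Hz0] Hmin]].
  - apply bounded2_bound with (N c0 + Rabs (fst y) + Rabs (snd y) + 2).
    intros p [_ Hp]; unfold N in Hp at 1.
    (* From [|s| <= s ^ 2 + 1] with [s = u - v]; this bounds the coordinates without square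
       roots. *)
    assert (Hs : forall u v : R, Rabs u <= (u - v) ^ 2 + Rabs v + 1).
    { intros u v; pose proof (Rabs_triang (u - v) v) as Ht.
      replace (u - v + v) with u in Ht by ring.
      pose proof (pow2_abs (u - v)); pose proof (pow2_ge_0 (Rabs (u - v) - 1)).
      pose proof (Rabs_pos (u - v)); lra. }
    pose proof (Hs (fst p) (fst y)); pose proof (Hs (snd p) (snd y)); lra.
  - exists c0; split; [exact Hc0|lra].
  - intros x Hx; exists c0; split; [split; [exact Hc0|lra]|].
    destruct (classic (C x)) as [HCx|HCx].
    + assert (Hlt : N c0 < N x).
      { apply Rnot_le_lt; intros Hle; apply Hx; auto. }
      apply filter_imp with (fun p => N c0 < N p).
      * intros p Hp _; lra.
      * apply (HN x (fun t => N c0 < t)), open_gt; exact Hlt.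
    + assert (Hloc : locally x (fun p => ~ C p)).
      { apply NNPP; intros H; apply HCx, Hcl; exact H. }
      apply filter_imp with (2 := Hloc); tauto.
  - intros x _; apply (continuous_opp (K := R_AbsRing) (V := R_NormedModule)), HN.
  - exists z; split; [exact Hz|].
    intros c Hc; destruct (Rle_lt_dec (N c) (N c0)) as [Hle|Hlt].
    + specialize (Hmin c (conj Hc Hle)); unfold N in Hmin; lra.
    + unfold N in Hlt, Hz0; lra.
Qed.

(** The separating line passes through the point [z] of [C] nearest to [y] and is normal to [y - z].
    An empty [C] is treated apart, having no such [z]. *)
Lemma closed_convex_separation (C : pt -> Prop) (y : pt) :
  convex2 C -> closed C -> ~ C y ->
  exists a b c, 0 < a ^ 2 + b ^ 2 /\ c < a * fst y + b * snd y /\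
    forall p, C p -> a * fst p + b * snd p <= c.
Proof.
  intros Hconv Hcl Hy.
  destruct (classic (exists c, C c)) as [Hne|He].
  2: { exists 1, 0, (fst y - 1); split; [lra|]; split; [lra|].
       intros p Hp; destruct He; exists p; exact Hp. }
  destruct (nearest_point C y Hne Hcl) as [z [Hz Hmin]].
  exists (fst y - fst z), (snd y - snd z),
    ((fst y - fst z) * fst z + (snd y - snd z) * snd z).
  assert (Hpos : 0 < (fst y - fst z) ^ 2 + (snd y - snd z) ^ 2).
  { pose proof (pow2_ge_0 (fst y - fst z)); pose proof (pow2_ge_0 (snd y - snd z)).
    apply Rnot_le_lt; intros Hle; apply Hy.
    replace y with z; [exact Hz|].
    destruct y as [y1 y2], z as [z1 z2]; simpl fst in *; simpl snd in *.
    assert (H1 : (y1 - z1) ^ 2 = 0) by lra.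
    assert (H2 : (y2 - z2) ^ 2 = 0) by lra.
    rewrite <- Rsqr_pow2 in H1, H2; apply Rsqr_0_uniq in H1; apply Rsqr_0_uniq in H2.
    f_equal; lra. }
  split; [exact Hpos|]; split; [lra|].
  intros p Hp.
  (* Moving from [z] towards [p] by [t] does not decrease the distance to [y];
     the first-order term in [t] gives the claim. *)
  apply Rnot_lt_le; intros Hlt.
  set (s := (fst y - fst z) * (fst p - fst z) + (snd y - snd z) * (snd p - snd z)).
  set (m := (fst p - fst z) ^ 2 + (snd p - snd z) ^ 2).
  assert (Hs : 0 < s) by (unfold s; lra).
  assert (Hm : 0 <= m).
  { unfold m; pose proof (pow2_ge_0 (fst p - fst z));
      pose proof (pow2_ge_0 (snd p - snd z)); lra. }
  (* This [t] lies in []0, 1]], even when [m = 0], and gives [2 * s - t * m = s + t * s > 0]. *)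
  set (t := s / (s + m)).
  assert (Ht : t * (s + m) = s) by (unfold t; field; lra).
  assert (Ht0 : 0 < t) by (apply Rdiv_lt_0_compat; lra).
  assert (Ht1 : t <= 1).
  { apply Rmult_le_reg_r with (s + m); lra. }
  assert (H : t * (2 * s - t * m) <= 0).
  { specialize (Hmin _ (Hconv p z t Hp Hz (conj (Rlt_le _ _ Ht0) Ht1))).
    simpl fst in Hmin; simpl snd in Hmin; unfold s, m; lra. }
  assert (H' : 0 < t * (2 * s - t * m)).
  { apply Rmult_lt_0_compat; [exact Ht0|].
    assert (0 < t * s) by (apply Rmult_lt_0_compat; assumption); lra. }
  lra.
Qed.

(** * First-order conditions for the tilted gradient *)

Lemma is_derive_local_max (f : R -> R) (x l : R) :
  is_derive f x l -> locally x (fun t => f t <= f x) -> l = 0.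
Proof.
  intros Hd [d Hmax].
  assert (pr : derivable_pt f x) by (exists l; apply is_derive_Reals; exact Hd).
  rewrite <- (is_derive_unique _ _ _ Hd), <- (Derive_Reals f x pr).
  apply (deriv_maximum f (x - d) (x + d) x pr); try (pose proof (cond_pos d); lra).
  intros t H1 H2; apply Hmax.
  change (Rabs (t - x) < d); apply Rabs_lt_between'; lra.
Qed.

Lemma C2_on_symmetric (D : pt -> Prop) (w : pt -> R) (p : pt) :
  open D -> C2_on D w -> D p -> pdx (pdy w) p = pdy (pdx w) p.
Proof.
  intros HO HC Hp; destruct p as [x y].
  pose proof (HC _ Hp) as (_ & _ & _ & _ & _ & _ & _ & _ & _ & _ & Hyx & Hxy & _).
  apply (Schwarz (fun u v => w (u, v)) x y).
  - apply locally_2d_locally.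
    apply filter_imp with (2 := HO _ Hp); intros [u v] Huv.
    pose proof (HC _ Huv) as (_ & H1 & H2 & _ & _ & _ & H4 & H5 & _).
    repeat split; assumption.
  - apply continuity_2d_pt_filterlim; exact Hxy.
  - apply continuity_2d_pt_filterlim; exact Hyx.
Qed.

(* [a * p + b * q = lam * b] and [a * q + b * s = - lam * a] say that the
   symmetric matrix with rows [(p, q)], [(q, s)] maps [(a, b)] to
   [lam * (b, - a)]. *)
Lemma symmetric_rotation_det (a b p q s lam : R) :
  0 < a ^ 2 + b ^ 2 -> a * p + b * q = lam * b -> a * q + b * s = - lam * a ->
  p * s - q ^ 2 = - lam ^ 2.
Proof.
  intros Hab H1 H2.
  apply Rmult_eq_reg_l with (a ^ 2 + b ^ 2); [|lra].
  destruct (Req_dec a 0) as [->|Ha].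
  - assert (b <> 0) by (intros ->; lra).
    assert (q = lam) by (apply Rmult_eq_reg_l with b; lra).
    assert (s = 0) by (apply Rmult_eq_reg_l with b; lra).
    subst; ring.
  - assert (q = - lam - b * s / a).
    { apply Rmult_eq_reg_l with a; [field_simplify; lra|exact Ha]. }
    assert (p = b * (lam - q) / a).
    { apply Rmult_eq_reg_l with a; [field_simplify; lra|exact Ha]. }
    subst p; subst q; field; exact Ha.
Qed.

(** Abstract [f], [g], [k] let one computation serve both the horizontal and the vertical slices of
    the tilted function. *)
Lemma is_derive_tilted (f g k : R -> R) (a b lam l x : R) :
  ex_derive f x -> ex_derive g x -> is_derive k x l ->
  is_derive (fun t => 1 * (a * f t + b * g t) + lam * k t) x
    (a * Derive f x + b * Derive g x + lam * l).
Proof.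
  intros Hf Hg Hk; rewrite <- (is_derive_unique _ _ _ Hk); auto_derive.
  - repeat split; trivial; exists l; exact Hk.
  - change (fun t => f t) with f; change (fun t => g t) with g;
      change (fun t => k t) with k; ring.
Qed.

(** At a local maximum the two vanishing partial derivatives say that the Hessian of [w] maps
    [(a, b)] to [lam * (b, - a)], which [symmetric_rotation_det] excludes when the determinant is
    non-negative. *)
Lemma no_local_max_tilted_gradient (D : pt -> Prop) (w : pt -> R) (a b lam : R) (x : pt) :
  open D -> C2_on D w ->
  (forall p, D p -> 0 <= pdx (pdx w) p * pdy (pdy w) p - (pdy (pdx w) p) ^ 2) ->
  0 < a ^ 2 + b ^ 2 -> lam <> 0 -> D x ->
  let F p := 1 * (a * pdx w p + b * pdy w p) + lam * (a * snd p + (- b) * fst p) in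
  ~ locally x (fun p => F p <= F x).
Proof.
  intros HO HC Hdet Hab Hlam Hx F Hmax.
  pose proof (C2_on_symmetric D w x HO HC Hx) as Hsym.
  pose proof (HC _ Hx) as (_ & _ & _ & _ & _ & Hxx & Hyx & Hxy & Hyy & _).
  specialize (Hdet x Hx); destruct x as [x y].
  assert (Hloc : locally_2d (fun u v => F (u, v) <= F (x, y)) x y).
  { apply locally_2d_locally; apply filter_imp with (2 := Hmax).
    intros [u v] H; exact H. }
  assert (H1 : a * pdx (pdx w) (x, y) + b * pdx (pdy w) (x, y) - lam * b = 0).
  { apply (is_derive_local_max (fun t => F (t, y)) x).
    - replace (_ - lam * b) with
        (a * pdx (pdx w) (x, y) + b * pdx (pdy w) (x, y) + lam * - b) by ring.
      apply (is_derive_tilted (fun t => pdx w (t, y)) (fun t => pdy w (t, y))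
        (fun t => a * y + - b * t)); [exact Hxx|exact Hxy|].
      auto_derive; [trivial|ring].
    - apply (locally_2d_1d_const_y _ _ _ Hloc). }
  assert (H2 : a * pdy (pdx w) (x, y) + b * pdy (pdy w) (x, y) + lam * a = 0).
  { apply (is_derive_local_max (fun t => F (x, t)) y).
    - apply (is_derive_tilted (fun t => pdx w (x, t)) (fun t => pdy w (x, t))
        (fun t => a * t + - b * x)); [exact Hyx|exact Hyy|].
      auto_derive; [trivial|ring].
    - apply (locally_2d_1d_const_x _ _ _ Hloc). }
  rewrite Hsym in H1.
  rewrite (symmetric_rotation_det a b _ _ _ lam Hab) in Hdet by lra.
  pose proof (pow2_gt_0 lam Hlam); lra.
Qed.

(** * Contradiction from a [psi] for which every boundary point fails *)

Theorem theorem5 (Omega : pt -> Prop) (h w : pt -> R) :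
  open Omega -> bounded2 Omega -> (exists p, Omega p) ->
  (forall p, Omega p -> continuous h p) ->
  (forall p, Omega p -> 0 <= h p) ->
  C2_on Omega w ->
  (forall p, Omega p ->
     pdx (pdx w) p * pdy (pdy w) p - (pdy (pdx w) p) ^ 2 = h p) ->
  convex_hull_like Omega (fun p => (pdx w p, pdy w p)).
Proof.
  intros HO HB Hne _ Hh HC HMA psi Hpsi Hqc.
  apply NNPP; intros Hno.
  set (g := fun p => psi (pdx w p, pdy w p)) in *.
  (* A point outside [Omega] is either a boundary point, where the limsup differs from the supremum,
     or has a neighbourhood disjoint from [Omega], where any level works. *)
  assert (Hout : forall x, ~ Omega x -> exists q r, Omega q /\ r < g q /\
    locally x (fun p => Omega p -> g p <= r)).
  { intros x Hx; destruct (classic (closure2 Omega x)) as [Hcl|Hcl].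
    - apply limsup_within_lt_sup_on; intros Heq; apply Hno; exists x.
      split; [split; [exact Hcl|]|exact Heq].
      intros eps He; exists x; split; [exact Hx|].
      unfold dist2; rewrite !Rminus_diag; replace (0 ^ 2 + 0 ^ 2) with 0 by ring.
      rewrite sqrt_0; exact He.
    - destruct Hne as [q Hq]; exists q, (g q - 1).
      split; [exact Hq|]; split; [lra|].
      apply filter_imp with (2 := not_closure2_locally _ _ Hcl); tauto. }
  assert (Hg : forall p, Omega p -> continuous g p).
  { intros p Hp; pose proof (HC p Hp) as (_ & _ & _ & Hx & Hy & _).
    apply (continuous_comp_2 (pdx w) (pdy w) (fun u v => psi (u, v)));
      [exact Hx|exact Hy|].
    apply (continuous_ext psi); [intros [u v]; reflexivity|apply Hpsi]. }
  destruct (max_attained Omega g HB Hne) as [x0 [Hx0 Hmax]].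
  { intros x Hx; destruct (Hout x Hx) as [q [r [Hq [Hr Hloc]]]].
    exists q; split; [exact Hq|]; apply filter_imp with (2 := Hloc).
    intros p H Hp; specialize (H Hp); lra. }
  { exact Hg. }
  destruct (max_near_complement Omega g x0 HO HB Hx0 Hmax Hout) as [r [Hr Hnear]].
  destruct (closed_convex_separation (fun q => psi q <= r) (pdx w x0, pdy w x0))
    as [a [b [c [Hab [Hc Hsep]]]]].
  - apply Hqc.
  - apply (closed_comp psi (fun t => t <= r)); [intros; apply Hpsi|apply closed_le].
  - apply Rlt_not_le; exact Hr.
  - simpl in Hc; destruct HB as [M HM].
    set (K := (Rabs a + Rabs b) * M).
    assert (HK : forall p, Omega p -> Rabs (a * snd p + (- b) * fst p) <= K).
    { intros p Hp; apply Rle_trans with (1 := Rabs_triang _ _).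
      rewrite !Rabs_mult, Rabs_Ropp.
      destruct (abs_coord_le_dist2 p (0, 0)) as [H1 H2]; simpl in H1, H2.
      rewrite Rminus_0_r in H1, H2; specialize (HM p Hp).
      unfold K; rewrite Rmult_plus_distr_r.
      apply Rplus_le_compat; apply Rmult_le_compat_l; try apply Rabs_pos; lra. }
    assert (HK0 : 0 <= K) by (apply Rle_trans with (2 := HK x0 Hx0), Rabs_pos).
    set (gap := a * pdx w x0 + b * pdy w x0 - c).
    (* The tilt then varies by at most [2 * (lam * K) = gap - lam] over [Omega], strictly less than
       the gap; the [+ 1] also keeps the denominator positive when [K = 0]. *)
    set (lam := gap / (2 * K + 1)).
    assert (Hlam : 0 < lam) by (apply Rdiv_lt_0_compat; unfold gap; lra).
    assert (Hgap : 2 * (lam * K) + lam = gap) by (unfold lam; field; lra).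
    assert (HlamK : forall p, Omega p ->
      Rabs (lam * (a * snd p + (- b) * fst p)) <= lam * K).
    { intros p Hp; rewrite Rabs_mult, (Rabs_pos_eq lam) by lra.
      apply Rmult_le_compat_l; [lra|auto]. }
    set (F := fun p =>
      1 * (a * pdx w p + b * pdy w p) + lam * (a * snd p + (- b) * fst p)).
    destruct (max_attained Omega F) as [x1 [Hx1 HF]].
    + exists M; exact HM.
    + exact Hne.
    (* Near the complement [psi] of the gradient is at most [r], so the linear form is at most [c]
       there, and the tilt cannot make up the gap to [x0]. *)
    + intros x Hx; exists x0; split; [exact Hx0|].
      apply filter_imp with (2 := Hnear x Hx); intros p Hp HpO.
      pose proof (Hsep _ (Hp HpO)) as Hs; simpl in Hs.
      pose proof (proj1 (Rabs_le_between _ _) (HlamK p HpO)).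
      pose proof (proj1 (Rabs_le_between _ _) (HlamK x0 Hx0)).
      unfold F, gap in *; lra.
    + intros x Hx; pose proof (HC x Hx) as (_ & _ & _ & Hcx & Hcy & _).
      apply continuous_lincomb; apply continuous_lincomb; trivial;
        [apply continuous_snd_pt|apply continuous_fst_pt].
    + apply (no_local_max_tilted_gradient Omega w a b lam x1); trivial.
      * intros p Hp; rewrite HMA by exact Hp; auto.
      * lra.
      * apply filter_imp with (2 := HO x1 Hx1); exact HF.
Qed.
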